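(* For integers $r,n\ge 0$ let $f_r(n)$ denote the number of permutations in $S_n$ that avoid the generalized pattern $12\text{-}3$ and contain exactly $r$ occurrences of the generalized pattern $23\text{-}1$, and let $F_r(x)=\sum_{n\ge 0} f_r(n)x^n$. Then for every integer $r\ge 0$, $$F_r(x)=\frac{\delta_{r,0}}{1-x}+x^2\sum_{d=0}^{r}(1-x)^{d-2}\left[F_{r-d}\!\left(\frac{x}{1-x}\right)-\sum_{j=0}^{d-1}f_{r-d}(j)\left(\frac{x}{1-x}\right)^{j}\right].$$
   Context: $S_n$ is the set of permutations $\pi=\pi_1\pi_2\cdots\pi_n$ of $\{1,\dots,n\}$; $S_0$ consists of the empty permutation only. An occurrence of a generalized pattern $ab\text{-}c$ (with $abc$ a permutation of $\{1,2,3\}$) in $\pi$ is a pair $(i,j)$ with $i+1<j\le n$ such that $(\pi_i,\pi_{i+1},\pi_j)$ is order-isomorphic to $(a,b,c)$ (so the first two letters are adjacent in $\pi$). $\pi$ avoids the pattern if it has no occurrence of it. $\delta_{r,0}$ is the Kronecker delta; an empty sum is $0$. The identity is one of formal power series. *)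

(* Defs.v *)
From HB Require Import structures.
From mathcomp Require Import all_boot all_order all_algebra all_fingroup.
From mathcomp Require Import boolp classical_sets.

Set Implicit Arguments.
Unset Strict Implicit.
Unset Printing Implicit Defensive.

Import GRing.Theory.

(* Formal power series sum_n (fcoef F n) x^n; equality and choice on them are
   classical. *)
Record fps (R : Type) := Fps { fcoef : nat -> R }.

Lemma fpsP (R : Type) (F G : fps R) : fcoef F =1 fcoef G <-> F = G.
Proof.
split=> [|-> //]; case: F G => [f] [g] /= fg.
by congr Fps; apply/funext.
Qed.

HB.instance Definition _ (R : Type) := gen_eqMixin (fps R).
HB.instance Definition _ (R : Type) := gen_choiceMixin (fps R).

Section FpsRing.
Local Open Scope ring_scope.
Variable R : comNzRingType.
Implicit Types F G H : fps R.

Definition fps_zero : fps R := Fps (fun _ => 0).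
Definition fps_opp F : fps R := Fps (fun n => - fcoef F n).
Definition fps_add F G : fps R := Fps (fun n => fcoef F n + fcoef G n).

Fact fps_addA : associative fps_add.
Proof. by move=> F G H; apply/fpsP => n /=; rewrite addrA. Qed.
Fact fps_addC : commutative fps_add.
Proof. by move=> F G; apply/fpsP => n /=; rewrite addrC. Qed.
Fact fps_add0 : left_id fps_zero fps_add.
Proof. by move=> F; apply/fpsP => n /=; rewrite add0r. Qed.
Fact fps_addN : left_inverse fps_zero fps_opp fps_add.
Proof. by move=> F; apply/fpsP => n /=; rewrite addNr. Qed.

HB.instance Definition _ :=
  GRing.isZmodule.Build (fps R) fps_addA fps_addC fps_add0 fps_addN.

Definition fps_one : fps R := Fps (fun n => (n == 0)%N%:R).
Definition fps_mul F G : fps R :=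
  Fps (fun n => \sum_(i < n.+1) fcoef F i * fcoef G (n - i)%N).

Definition fps_trunc m F : {poly R} := \poly_(i < m) fcoef F i.

Fact fcoef_mul_trunc m n F G :
  (n < m)%N -> fcoef (fps_mul F G) n = (fps_trunc m F * fps_trunc m G)`_n.
Proof.
move=> nm; rewrite coefM /=; apply: eq_bigr => i _; rewrite !coef_poly.
have im : (i < m)%N by apply: leq_ltn_trans nm; rewrite -ltnS.
by rewrite im (leq_ltn_trans (leq_subr _ _) nm).
Qed.

Fact fps_mulC : commutative fps_mul.
Proof.
by move=> F G; apply/fpsP => n; rewrite !(@fcoef_mul_trunc n.+1) // mulrC.
Qed.

Fact fps_mulA : associative fps_mul.
Proof.
move=> F G H; apply/fpsP => n.
transitivity ((fps_trunc n.+1 F * (fps_trunc n.+1 G * fps_trunc n.+1 H))`_n).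
  rewrite coefM /=; apply: eq_bigr => i _.
  rewrite -(@fcoef_mul_trunc n.+1) ?ltnS ?leq_subr // coef_poly.
  by rewrite ltn_ord.
rewrite mulrA coefM /=; apply: eq_bigr => i _.
rewrite -(@fcoef_mul_trunc n.+1) ?ltn_ord // coef_poly.
by rewrite ltnS leq_subr.
Qed.

Fact fps_mul1 : left_id fps_one fps_mul.
Proof.
move=> F; apply/fpsP => n /=; rewrite big_ord_recl /= mul1r subn0.
by rewrite big1 ?addr0 // => i _; rewrite mul0r.
Qed.

Fact fps_mulDl : left_distributive fps_mul fps_add.
Proof.
move=> F G H; apply/fpsP => n /=; rewrite -big_split /=.
by apply: eq_bigr => i _; rewrite mulrDl.
Qed.

Fact fps_one_neq0 : fps_one != 0.
Proof.
apply/eqP => /fpsP /(_ 0%N) /= /eqP; by rewrite oner_eq0.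
Qed.

HB.instance Definition _ := GRing.Zmodule_isComNzRing.Build (fps R)
  fps_mulA fps_mulC fps_mul1 fps_mulDl fps_one_neq0.

(* The units are the invertible series; as usual in MathComp the inverse of a
   non-unit is the series itself. *)
Definition fps_unit : {pred fps R} := fun F => `[< exists G, G * F = 1 >].
Definition fps_inv F : fps R := xget F [set G | G * F = 1].

Fact fps_mulV : {in fps_unit, left_inverse 1 fps_inv *%R}.
Proof.
move=> F /asboolP [G GF].
by apply: (@xgetPex _ F [set G | G * F = 1]); exists G.
Qed.
Fact fps_unitP F G : G * F = 1 -> F \in fps_unit.
Proof. by move=> GF; apply/asboolP; exists G. Qed.
Fact fps_inv_out : {in [predC fps_unit], fps_inv =1 id}.
Proof.
move=> F /asboolP FN; rewrite /fps_inv xgetPN // => G /= GF.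
by apply: FN; exists G.
Qed.

HB.instance Definition _ := GRing.ComNzRing_hasMulInverse.Build (fps R)
  fps_mulV fps_unitP fps_inv_out.

Definition fpsX : fps R := Fps (fun n => (n == 1)%N%:R).

(* Substitution F(G) of a series G with zero constant term: then G ^+ k has no
   term of degree < k, so the coefficient of degree n of \sum_k F_k G^k is the
   finite sum below. It is not meaningful if G has a nonzero constant term. *)
Definition fps_subst F G : fps R :=
  Fps (fun n => \sum_(k < n.+1) fcoef F k * fcoef (G ^+ k) n).

Lemma fps_unit_1subX : 1 - fpsX \is a GRing.unit.
Proof.
apply: (@fps_unitP _ (Fps (fun=> 1))).
rewrite mulrC mulrBl mul1r; apply/fpsP => -[|n] /=.
  by rewrite big_ord_recl big_ord0 /= mul0r addr0 subr0.
rewrite 2!big_ord_recl /= mul0r add0r mulr1.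
by rewrite big1 ?addr0 ?subrr // => i _; rewrite mul0r.
Qed.

End FpsRing.

Arguments fpsX {R}.

(* The one-line notation [:: p_1; ...; p_n] of p, with letters in {1, ..., n};
   the letter p_(i+1) is at position i of the sequence. *)
Definition word n (p : 'S_n) : seq nat := [seq (val (p i)).+1 | i <- enum 'I_n].

Definition order_iso (s t : seq nat) : bool :=
  (size s == size t) &&
  [forall i : 'I_(size s), forall j : 'I_(size s),
     (nth 0 s i < nth 0 s j)%N == (nth 0 t i < nth 0 t j)%N].

(* The occurrences of the generalized pattern ab-c in p, as pairs of positions
   counted from 0. *)
Definition occurrences (a b c : nat) n (p : 'S_n) : {set 'I_n * 'I_n} :=
  [set ij : 'I_n * 'I_n | (ij.1.+1 < ij.2)%N &&
     order_iso [:: nth 0 (word p) ij.1; nth 0 (word p) ij.1.+1;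
                   nth 0 (word p) ij.2] [:: a; b; c]].

Definition avoids (a b c : nat) n (p : 'S_n) : bool :=
  #|occurrences a b c p| == 0.

Definition f (r n : nat) : nat :=
  #|[set p : 'S_n | avoids 1 2 3 p & #|occurrences 2 3 1 p| == r]|.

Definition genF (r : nat) : fps int := Fps (fun n => (f r n)%:R%R).

(* Main.v *)
(** Peel off the first letter k of a permutation counted by f_r(n). If k is
   the maximum it takes part in no occurrence, leaving f_r(n-1). Otherwise the
   second letter is either smaller than k, and then k takes part in no
   occurrence, or, by avoidance of 12-3, it is the maximum; in that case each of
   the k-1 letters below k completes a 23-1 and an arbitrary permutation of
   size n-2 remains. Unrolling the descents by Pascal's rule gives
     f_r(n+2) = f_r(n+1) + sum_d sum_(j >= d) f_(r-d)(j) binom(n-d, j-d),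
   and binom(n-d, j-d) is the coefficient of x^n in (1-x)^(d-1) (x/(1-x))^j, so
   this is the coefficient of x^(n+2) in the identity multiplied by 1-x. *)

Require Import Defs.
From mathcomp Require Import all_boot all_order all_algebra all_fingroup.
From mathcomp Require Import zify.

Import GRing.Theory.

(** * Pattern counts of words *)

(** Recursion on the word, so that prepending a letter adds a single explicit term: the third
    letters that complete the first adjacent pair. *)
Fixpoint pattern_count (P : nat -> nat -> pred nat) (w : seq nat) : nat :=
  if w is x :: w' then
    (if w' is y :: w'' then count (P x y) w'' else 0) + pattern_count P w'
  else 0.

Lemma pattern_countE P w :
  \sum_(i < size w) \sum_(j < size w)
     ((i.+1 < j) && P (nth 0 w i) (nth 0 w i.+1) (nth 0 w j) : nat)
  = pattern_count P w.
Proof.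
elim: w => [|x w IH] /=; first by rewrite big_ord0.
rewrite big_ord_recl /= -IH; congr (_ + _).
  rewrite big_ord_recl /= add0n.
  case: w {IH} => [|y w] /=; first by rewrite big_ord0.
  rewrite big_ord_recl /= add0n -sum1_count (big_nth 0) big_mkord [RHS]big_mkcond.
  by apply: eq_bigr => j _ /=; case: (P _ _ _).
apply: eq_bigr => i _; rewrite big_ord_recl /= add0n.
by apply: eq_bigr => j _; rewrite /bump /= !add1n ltnS ?add0n.
Qed.

Lemma eq_pattern_count P Q w :
  (forall x y z, P x y z = Q x y z) -> pattern_count P w = pattern_count Q w.
Proof.
move=> PQ; elim: w => [|x w IH] //=; rewrite IH; case: w {IH} => // y w; congr (_ + _).
by apply: eq_count => z; rewrite PQ.
Qed.

Lemma pattern_count_map h P w :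
  (forall x y z, P (h x) (h y) (h z) = P x y z) ->
  pattern_count P (map h w) = pattern_count P w.
Proof.
move=> hP; elim: w => [|x w IH] //=; rewrite IH; case: w {IH} => //= y w; congr (_ + _).
by rewrite count_map; apply: eq_count => z /=; rewrite hP.
Qed.

Definition occ123 := pattern_count (fun x y z => x < y < z).
Definition occ231 := pattern_count (fun x y z => z < x < y).

Lemma size_word n (p : 'S_n) : size (word p) = n.
Proof. by rewrite size_map size_enum_ord. Qed.

Lemma card_occurrences a b c n (p : 'S_n) :
  #|occurrences a b c p| =
  pattern_count (fun x y z => order_iso [:: x; y; z] [:: a; b; c]) (word p).
Proof.
rewrite -pattern_countE size_word pair_bigA /= -sum1_card big_mkcond /=.
by apply: eq_bigr => -[i j] _; rewrite inE /=; case: ifP.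
Qed.

(** Letters may coincide here, so each pair is compared in both directions. For a concrete pattern,
    [lia] then settles the rest. *)
Lemma order_iso3 x y z a b c :
  order_iso [:: x; y; z] [:: a; b; c] =
  [&& (x < y) == (a < b), (y < x) == (b < a), (x < z) == (a < c),
      (z < x) == (c < a), (y < z) == (b < c) & (z < y) == (c < b)].
Proof.
apply/idP/idP; last first.
  case/and5P=> h1 h2 h3 h4 /andP[h5 h6]; apply/forallP => -[[|[|[|i]]] //= ?];
  by apply/forallP => -[[|[|[|j]]] //= ?]; rewrite ?ltnn ?eqxx.
move=> /forallP /= h.
have g (i j : 'I_3) := forallP (h i) j.
pose i0 : 'I_3 := @Ordinal 3 0 isT; pose i1 : 'I_3 := @Ordinal 3 1 isT.
pose i2 : 'I_3 := @Ordinal 3 2 isT.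
apply/and5P; split.
- exact: (g i0 i1).
- exact: (g i1 i0).
- exact: (g i0 i2).
- exact: (g i2 i0).
by apply/andP; split; [exact: (g i1 i2)|exact: (g i2 i1)].
Qed.

Lemma card_occurrences123 n (p : 'S_n) : #|occurrences 1 2 3 p| = occ123 (word p).
Proof.
rewrite card_occurrences; apply: eq_pattern_count => x y z.
by rewrite order_iso3; lia.
Qed.

Lemma card_occurrences231 n (p : 'S_n) : #|occurrences 2 3 1 p| = occ231 (word p).
Proof.
rewrite card_occurrences; apply: eq_pattern_count => x y z.
by rewrite order_iso3; lia.
Qed.

(** * Permutations as words; removal of the first letter *)

Lemma perm_word n (p : 'S_n) : perm_eq (word p) (iota 1 n).
Proof.
have up : uniq (word p).
  rewrite map_inj_uniq ?enum_uniq // => i j [] /val_inj; exact: perm_inj.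
apply: uniq_perm; rewrite ?iota_uniq //.
apply: (uniq_min_size up _ _).2; last by rewrite size_word size_iota.
by move=> _ /mapP[i _ ->]; rewrite mem_iota add1n !ltnS /=.
Qed.

Definition count_words n (Q : pred (seq nat)) := #|[pred p : 'S_n | Q (word p)]|.

Lemma eq_count_words n (Q Q' : pred (seq nat)) :
  (forall w, perm_eq w (iota 1 n) -> Q w = Q' w) -> count_words n Q = count_words n Q'.
Proof. by move=> QQ; apply: eq_card => p; rewrite !inE QQ ?perm_word. Qed.

(** The letters of [word s] from [k.+1] on move up by one, which frees the value [k.+1] for the new
    first letter. *)
Lemma word_lift_perm n (k : 'I_n.+1) (s : 'S_n) :
  word (lift_perm ord0 k s) = k.+1 :: map (bump k.+1) (word s).
Proof.
rewrite /word enum_ordSl /= lift_perm_id -!map_comp; congr (_ :: _).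
by apply: eq_map => i /=; rewrite lift_perm_lift /= bumpS.
Qed.

Lemma count_words0 Q : count_words 0 Q = Q [::].
Proof.
have wE (p : 'S_0) : word p = [::] by apply: size0nil; rewrite size_word.
rewrite /count_words (eq_card (B := [pred p : 'S_0 | Q [::]])); last first.
  by move=> p; rewrite !inE wE.
by case: (Q _); rewrite ?card0 ?(eq_card (B := 'S_0)) ?card_Sn.
Qed.

Lemma bij_lift_perm n :
  bijective (fun ks : 'I_n.+1 * 'S_n => lift_perm ord0 ks.1 ks.2).
Proof.
apply: inj_card_bij; last by rewrite card_prod !card_Sn card_ord factS.
move=> [k s] [l t] /= /permP kslt; have := kslt ord0.
rewrite !lift_perm_id => kl; congr (_, _); first exact: kl.
apply/permP => i; have := kslt (lift ord0 i).
by rewrite !lift_perm_lift kl => /lift_inj.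
Qed.

Lemma count_wordsS n Q :
  count_words n.+1 Q =
  \sum_(k < n.+1) count_words n (fun w => Q (k.+1 :: map (bump k.+1) w)).
Proof.
transitivity (\sum_(k < n.+1) \sum_(s : 'S_n) (Q (word (lift_perm ord0 k s)) : nat)).
  rewrite pair_bigA /count_words -sum1_card big_mkcond /=.
  rewrite (reindex _ (onW_bij _ (bij_lift_perm n))) /=.
  by apply: eq_bigr => ks _; rewrite inE; case: (Q _).
apply: eq_bigr => k _; rewrite /count_words -sum1_card [RHS]big_mkcond /=.
by apply: eq_bigr => s _; rewrite inE word_lift_perm; case: (Q _).
Qed.

(** * Effect of the first letter on the two pattern counts *)

Definition good (r : nat) (w : seq nat) := (occ123 w == 0) && (occ231 w == r).

Lemma f_count r n : f r n = count_words n (good r).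
Proof.
apply: eq_card => p.
by rewrite !inE /avoids card_occurrences123 card_occurrences231.
Qed.

Lemma occ123_bump k w : occ123 (map (bump k) w) = occ123 w.
Proof. by apply: pattern_count_map => x y z; rewrite !ltnNge !leq_bump2. Qed.

Lemma occ231_bump k w : occ231 (map (bump k) w) = occ231 w.
Proof. by apply: pattern_count_map => x y z; rewrite !ltnNge !leq_bump2. Qed.

Lemma good_cons_desc r x y w : y < x -> good r [:: x, y & w] = good r (y :: w).
Proof.
move=> yx; rewrite /good /occ123 /occ231 /=.
rewrite (eq_count (a2 := pred0)) ?count_pred0; last by move=> z /=; lia.
by rewrite (eq_count (a2 := pred0)) ?count_pred0 // => z /=; lia.
Qed.

(** After an initial ascent, a later letter above [y] would complete a 12-3, and each later letter
    below [x] completes a 23-1. *)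
Lemma good_cons_asc r x y w : x < y ->
  good r [:: x, y & w] =
  [&& all (geq y) w, occ123 (y :: w) == 0 &
      count (gtn x) w + occ231 (y :: w) == r].
Proof.
move=> xy; rewrite /good {1}/occ123 {1}/occ231 /= addn_eq0 -andbA; congr (_ && _).
  rewrite -leqn0 leqNgt -has_count -all_predC.
  by apply: eq_all => z /=; rewrite xy -leqNgt.
congr (_ && (_ + _ == r)).
by apply: eq_count => z /=; rewrite xy andbT.
Qed.

Lemma occ123_cons_max x w : all (gtn x) w -> occ123 (x :: w) = occ123 w.
Proof.
case: w => //= y w /andP[/= yx _]; rewrite /occ123 /=.
by rewrite (eq_count (a2 := pred0)) ?count_pred0 // => z /=; lia.
Qed.

Lemma occ231_cons_max x w : all (gtn x) w -> occ231 (x :: w) = occ231 w.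
Proof.
case: w => //= y w /andP[/= yx _]; rewrite /occ231 /=.
by rewrite (eq_count (a2 := pred0)) ?count_pred0 // => z /=; lia.
Qed.

Lemma good_cons_max r x w : all (gtn x) w -> good r (x :: w) = good r w.
Proof. by move=> wx; rewrite /good occ123_cons_max ?occ231_cons_max. Qed.

(** * Recurrence by the first letter and its solution *)

Lemma map_bump_id k w : all (gtn k) w -> map (bump k) w = w.
Proof.
move=> /allP wk; apply: map_id_in => x /wk /= xk.
by rewrite /bump leqNgt xk.
Qed.

Lemma perm_iota_lt n w : perm_eq w (iota 1 n) -> all (gtn n.+1) w.
Proof. by move=> /perm_all ->; apply/allP => x /=; rewrite mem_iota add1n => /andP[]. Qed.

(* [count_first r n k] counts permutations of size n + 1 with first letter
   k + 1. *)
Definition count_first r n k :=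
  count_words n (fun w => good r (k.+1 :: map (bump k.+1) w)).

Lemma f_count_first r n : f r n.+1 = \sum_(k < n.+1) count_first r n k.
Proof. by rewrite f_count count_wordsS. Qed.

Lemma count_first_max r n : count_first r n n = f r n.
Proof.
rewrite f_count; apply: eq_count_words => w /perm_iota_lt wn.
by rewrite map_bump_id // good_cons_max.
Qed.

Lemma count_words_false n (Q : pred (seq nat)) :
  (forall w, perm_eq w (iota 1 n) -> ~~ Q w) -> count_words n Q = 0.
Proof.
move=> Q0; rewrite /count_words eq_card0 // => p.
by rewrite inE; apply/negbTE/Q0/perm_word.
Qed.

Lemma count_perm_iota n k w : k <= n -> perm_eq w (iota 1 n) -> count (gtn k.+1) w = k.
Proof.
move=> kn /seq.permP ->; rewrite -(subnKC kn) iotaD count_cat.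
rewrite (eq_in_count (a2 := predT)) ?count_predT ?size_iota; last first.
  by move=> x; rewrite mem_iota /=; lia.
rewrite (eq_in_count (a2 := pred0)) ?count_pred0 ?addn0 // => x.
by rewrite mem_iota /=; lia.
Qed.

(** Classification by the second letter: the product comes from the maximum, the sum from the
    letters smaller than the first one. *)
Lemma count_firstS r n k : k <= n ->
  count_first r n.+1 k = (k <= r) * f (r - k) n + \sum_(b < k) count_first r n b.
Proof.
move=> kn; rewrite {1}/count_first count_wordsS /=.
rewrite -(big_mkord xpredT (fun b => count_words n (fun w =>
  good r [:: k.+1, bump k.+1 b.+1 & map (bump k.+1) (map (bump b.+1) w)]))).
(* Indices [b < k] give a descent. Among the ascents the last index [b = n], where the second letter
   is the maximum, is set apart. *)
rewrite (big_cat_nat (n := k)) //= 1?leqW // addnC big_nat_recr //=; congr (_ + _).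
  rewrite big_nat_cond big1 ?add0n => [|b /andP[/andP[kb bn] _]].
    have -> : bump k.+1 n.+1 = n.+2 by rewrite /bump ltnS kn.
    have E w : perm_eq w (iota 1 n) ->
        good r [:: k.+1, n.+2 & map (bump k.+1) (map (bump n.+1) w)] =
        (k <= r) && good (r - k) w.
      move=> wn; have wlt := perm_iota_lt _ _ wn.
      have b2 : all (gtn n.+2) (map (bump k.+1) w).
        rewrite all_map; apply: sub_all wlt => x /=; rewrite /bump; lia.
      rewrite (map_bump_id n.+1) // good_cons_asc; last by lia.
      rewrite occ123_cons_max // occ231_cons_max // occ123_bump occ231_bump.
      rewrite count_map (eq_count (a2 := gtn k.+1)); last first.
        by move=> x; rewrite /= /bump; lia.
      rewrite (count_perm_iota _ _ _ kn wn) /good.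
      have -> : all (geq n.+2) (map (bump k.+1) w).
        by apply: sub_all b2 => x /=; lia.
      by case: (occ123 w == 0) => /=; lia.
    case: leqP => kr; rewrite ?mul1n ?mul0n.
      by rewrite f_count; apply: eq_count_words => w /E; rewrite kr.
    by apply: count_words_false => w /E ->; rewrite leqNgt kr.
  (* For [k <= b < n] the maximum [n.+2] is still to come, as the image of the letter [n] of [w],
     and completes a 12-3. *)
  apply: count_words_false => w wn.
  rewrite good_cons_asc; last by rewrite /bump; lia.
  have nw : n \in w by rewrite (perm_mem wn) mem_iota; lia.
  apply/negP => /andP[/allP /(_ _ (map_f _ (map_f _ nw)))] /=.
  by rewrite /bump; lia.
rewrite big_mkord; apply: eq_bigr => -[b bk] _ /=; apply: eq_count_words => w _.
(* As [b < k], the shift fixes the second letter, so everything after the first letter is the shift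
   of a word that starts with [b.+1]. *)
have bE : bump k.+1 b.+1 = b.+1 by rewrite /bump; lia.
rewrite bE good_cons_desc ?ltnS // -{1}bE.
by rewrite -[_ :: _]/(map (bump k.+1) (b.+1 :: _)) /good occ123_bump occ231_bump.
Qed.

(** Induction on [n], then on [m]. By [count_firstS] the new summand brings the term [e = m] and a
    sum of the same kind for the smaller size; Pascal's rule merges the latter with the sum already
    present. *)
Lemma sum_count_first r n m : m <= n.+1 ->
  \sum_(k < m) count_first r n.+1 k =
  \sum_(e < m) (e <= r) * \sum_(k < n.+1) 'C(m.-1 - e, k) * f (r - e) (n - k).
Proof.
elim: n m => [|n IHn] m; elim: m => [|m IHm] mn; rewrite ?big_ord0 //.
  move: mn; rewrite ltnS leqn0 => /eqP ->.
  rewrite !big_ord_recr !big_ord0 /= count_firstS // big_ord0 subnn bin0 mul1n.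
  by rewrite subn0 addn0.
rewrite ltnS in mn.
rewrite big_ord_recr /= IHm; last exact: leqW.
rewrite count_firstS // (IHn m) // [RHS]big_ord_recr /= addnCA addnC.
congr (_ + _); last first.
  rewrite subnn big_ord_recl bin0 mul1n subn0 big1 ?addn0 //.
rewrite -big_split /=; apply: eq_bigr => -[e em] _ /=.
rewrite -mulnDr; congr (_ * _).
have -> : m - e = (m.-1 - e).+1 by lia.
rewrite big_ord_recl [RHS]big_ord_recl !bin0 -addnA; congr (_ + _).
rewrite -big_split /=; apply: eq_bigr => k _.
by rewrite /bump !add1n binS mulnDl subSS.
Qed.

Lemma f_rec r n :
  f r n.+2 = f r n.+1 +
    \sum_(0 <= d < r.+1) \sum_(d <= j < n.+1) f (r - d) j * 'C(n - d, j - d).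
Proof.
rewrite f_count_first big_ord_recr /= count_first_max addnC; congr (_ + _).
rewrite sum_count_first //=.
rewrite -(big_mkord xpredT (fun e => (e <= r) *
  \sum_(k < n.+1) 'C(n - e, k) * f (r - e) (n - k))).
(* One side has [d <= n], the other [d <= r]. Both ranges are extended to a common bound; the left
   terms vanish for [d > r], the right ones for [d > n]. *)
rewrite (@big_nat_widen _ _ _ _ _ (n + r).+1) ?ltnS ?leq_addr //.
rewrite [RHS](@big_nat_widen _ _ _ _ _ (n + r).+1) ?ltnS ?leq_addl //.
rewrite [LHS]big_mkcond [RHS]big_mkcond /=; apply: eq_bigr => d _.
rewrite !ltnS; case: (leqP d r) => dr; last by case: ifP.
case: (leqP d n) => dn; last by rewrite big_geq.
rewrite mul1n (reindex_inj rev_ord_inj) /=.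
rewrite -(big_mkord xpredT (fun j =>
  'C(n - d, n.+1 - j.+1) * f (r - d) (n - (n.+1 - j.+1)))).
(* After the reversal [k = n - j], the terms with [j < d] vanish because [n - j > n - d]. *)
rewrite (big_cat_nat (n := d)) //= 1?leqW // big_nat big1 ?add0n => [|j jd]; last first.
  by rewrite bin_small ?mul0n //; lia.
rewrite !big_nat; apply: eq_bigr => j /andP[dj jn].
rewrite subSS subKn // mulnC -(bin_sub (n := n - d)); last by lia.
by congr (_ * 'C(_, _)); lia.
Qed.

Lemma f0 r : f r 0 = (r == 0).
Proof. by rewrite f_count count_words0 /good [_ == r]eq_sym. Qed.

Lemma f1 r : f r 1 = f r 0.
Proof. by rewrite f_count_first big_ord1 count_first_max. Qed.

(** * Coefficients of power series *)

Section FpsCoef.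
Local Open Scope ring_scope.
Variable R : comNzRingType.
Implicit Types F G : fps R.

Lemma fcoefD F G n : fcoef (F + G) n = fcoef F n + fcoef G n.
Proof. by []. Qed.

Lemma fcoefB F G n : fcoef (F - G) n = fcoef F n - fcoef G n.
Proof. by []. Qed.

Lemma fcoefM F G n : fcoef (F * G) n = \sum_(i < n.+1) fcoef F i * fcoef G (n - i).
Proof. by []. Qed.

Lemma fcoef_sum I (s : seq I) (P : pred I) (F : I -> fps R) n :
  fcoef (\sum_(i <- s | P i) F i) n = \sum_(i <- s | P i) fcoef (F i) n.
Proof. exact: (big_morph (fun F => fcoef F n) (fun _ _ => erefl) erefl). Qed.

Lemma fcoefMnatl k F n : fcoef (k%:R * F) n = k%:R * fcoef F n.
Proof.
rewrite !mulr_natl; elim: k => [|k IH]; first by rewrite !mulr0n.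
by rewrite !mulrS fcoefD IH.
Qed.

Lemma fcoefXM F n : fcoef (fpsX * F) n = if n is m.+1 then fcoef F m else 0.
Proof.
case: n => [|n] /=; first by rewrite big_ord_recl big_ord0 /= mul0r addr0.
rewrite 2!big_ord_recl /= mul0r add0r mul1r subSS subn0 big1 ?addr0 // => i _.
by rewrite mul0r.
Qed.

Lemma fcoefXnM j F n :
  fcoef (fpsX ^+ j * F) n = if (j <= n)%N then fcoef F (n - j) else 0.
Proof.
elim: j n => [|j IH] n; first by rewrite expr0 mul1r subn0.
by rewrite exprS -mulrA fcoefXM; case: n => [|n] //; rewrite IH.
Qed.

Definition binomial_fps k : fps R := Fps (fun n => 'C(n + k, k)%:R).

Lemma mul_1subX_binomial_fps k : (1 - fpsX) ^+ k.+1 * binomial_fps k = 1.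
Proof.
elim: k => [|k IH].
  apply/fpsP => n; rewrite expr1 mulrBl mul1r fcoefB fcoefXM.
  by case: n => [|n] /=; rewrite !bin0 ?subr0 ?subrr.
rewrite -[RHS]IH exprSr -mulrA; congr (_ * _); apply/fpsP => n.
rewrite mulrBl mul1r fcoefB fcoefXM; case: n => [|n] /=.
  by rewrite !add0n !binn subr0.
by rewrite addnS addSn binS natrD addrAC -addSnnS subrr add0r.
Qed.

Lemma binomial_fpsE k : binomial_fps k = (1 - fpsX) ^- k.+1.
Proof.
by rewrite -[LHS](mulKr (unitrX k.+1 (fps_unit_1subX R))) mul_1subX_binomial_fps mulr1.
Qed.

Lemma fcoefXn_div1subX j n : (n < j)%N ->
  fcoef ((fpsX / (1 - fpsX)) ^+ j : fps R) n = 0.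
Proof. by move=> nj; rewrite expr_div_n fcoefXnM leqNgt nj. Qed.

Lemma fcoef_subst_tail (a : nat -> nat) G d N n :
  (forall j m, (m < j)%N -> fcoef (G ^+ j) m = 0) -> (n < N)%N ->
  fcoef (fps_subst (Fps (fun j => (a j)%:R)) G - \sum_(0 <= j < d) (a j)%:R * G ^+ j) n =
  \sum_(d <= j < N) (a j)%:R * fcoef (G ^+ j) n.
Proof.
move=> G0 nN; rewrite fcoefB fcoef_sum.
under eq_bigr => j _ do rewrite fcoefMnatl.
(* The bound [maxn d N] only adds zero terms, and it lets the first [d] terms be split off even when
   [d] exceeds [N]. *)
have -> : fcoef (fps_subst (Fps (fun j => (a j)%:R)) G) n =
    \sum_(0 <= j < maxn d N) (a j)%:R * fcoef (G ^+ j) n.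
  rewrite (big_cat_nat (n := n.+1)) //=; last by rewrite leq_max nN orbT.
  rewrite big_mkord [X in _ + X]big_nat [X in _ + X]big1 ?addr0 // => j /andP[nj _].
  by rewrite G0 ?mulr0.
rewrite (big_cat_nat (n := d)) ?leq_maxl //= addrAC subrr add0r.
case: (leqP d N) => // dN.
by rewrite !big_geq // ltnW.
Qed.

(** The bound [n.+1] serves all coefficients of degree at most [n] at once, so the convolution and
    the sum over [j] can be exchanged. *)
Lemma fcoef_mul_subst_tail (a : nat -> nat) G H d n :
  (forall j m, (m < j)%N -> fcoef (G ^+ j) m = 0) ->
  fcoef (H * (fps_subst (Fps (fun j => (a j)%:R)) G
              - \sum_(0 <= j < d) (a j)%:R * G ^+ j)) n =
  \sum_(d <= j < n.+1) (a j)%:R * fcoef (H * G ^+ j) n.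
Proof.
move=> G0; rewrite fcoefM.
under eq_bigr => i _.
  rewrite (fcoef_subst_tail _ _ _ n.+1) ?ltnS ?leq_subr // mulr_sumr.
  over.
rewrite exchange_big; apply: eq_bigr => j _.
by rewrite fcoefM mulr_sumr; apply: eq_bigr => i _; rewrite mulrCA.
Qed.

(** The total exponent of [1 - fpsX] is [d - 1 - j], that is [-(j - d).+1], which is negative since
    [d <= j]; the series is thus a shifted [binomial_fps (j - d)]. *)
Lemma fcoef_expz_1subX_mul d j n : (d <= j <= n)%N ->
  fcoef ((1 - fpsX) ^ (d%:Z - 1) * (fpsX / (1 - fpsX)) ^+ j : fps R) n =
  'C(n - d, j - d)%:R.
Proof.
move=> /andP[dj jn].
suff -> : (1 - fpsX) ^ (d%:Z - 1) * (fpsX / (1 - fpsX)) ^+ j =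
    fpsX ^+ j * binomial_fps (j - d).
  by rewrite fcoefXnM jn /= addnBA // subnK.
have u1 := fps_unit_1subX R.
rewrite expr_div_n mulrCA binomial_fpsE; congr (_ * _).
rewrite !exprnN -exprzDr //.
by congr (_ ^ _); lia.
Qed.

End FpsCoef.

(** * Comparison of coefficients *)

Local Open Scope ring_scope.

Theorem theorem2p10 (r : nat) :
  let x : fps int := fpsX in
  let y : fps int := x / (1 - x) in
  genF r =
    (r == 0)%N%:R / (1 - x) +
    x ^+ 2 * \sum_(0 <= d < r.+1)
      (1 - x) ^ (d%:Z - 2) *
      (fps_subst (genF (r - d)) y - \sum_(0 <= j < d) (f (r - d) j)%:R * y ^+ j).
Proof.
move=> x y; have u1 : 1 - x \is a GRing.unit := fps_unit_1subX _.
(* Multiplication by the unit [1 - x] turns the left side into first differences of [f r] and the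
   exponent [d - 2] into [d - 1]. *)
apply: (mulrI u1); rewrite mulrDr mulrCA divrr // mulr1 mulrCA mulr_sumr.
under eq_bigr => d _.
  rewrite mulrA -{1}[1 - x]expr1z -exprzDr //.
  rewrite (_ : 1 + (d%:Z - 2) = d%:Z - 1); last by lia.
  over.
apply/fpsP => n; rewrite mulrBl mul1r fcoefB fcoefXM fcoefD fcoefXnM.
rewrite -[(r == 0)%N%:R]mulr1 fcoefMnatl.
(* Degrees 0 and 1 lie below the factor [x ^+ 2] and are the initial values; all higher degrees are
   [f_rec]. *)
case: n => [|[|n]] /=; rewrite ?mulr0 ?mulr1 ?add0r ?addr0 ?subr0.
- by rewrite f0.
- by rewrite f1 subrr.
rewrite f_rec natrD addrAC subrr add0r subn2 /= fcoef_sum natr_sum.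
apply: eq_bigr => d _; rewrite (fcoef_mul_subst_tail _ (f (r - d))); last first.
  by move=> j m; apply: fcoefXn_div1subX.
rewrite natr_sum !big_nat; apply: eq_bigr => j jn.
by rewrite fcoef_expz_1subX_mul // natrM.
Qed.
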